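(* Consider a short exact sequence of groups $1\to N\to G\to H\to 1$. If both $G$ and $N$ are finitely generated, then $\mathfrak{M}_{\mathtt{SFT}}(H)\subset\mathfrak{M}_{\mathtt{SFT}}(G)$ and $\mathfrak{M}_{\mathtt{SOF}}(H)\subset\mathfrak{M}_{\mathtt{SOF}}(G)$.
   Context: Alphabets are finite. For a group $G$ and alphabet $A$, $A^G=\{x\colon G\to A\}$ carries the prodiscrete topology and the shift action $(gx)(h)=x(g^{-1}h)$. A $G$-subshift is a closed $G$-invariant set $X\subset A^G$. For finite $F\subset G$ and a pattern $p\in A^F$ let $[p]=\{x\in A^G: x|_F=p\}$. $X$ is a subshift of finite type (SFT) if there is a finite set $\mathcal F$ of patterns with $X=\{x: gx\notin[p]\ \forall g\in G,\ p\in\mathcal F\}$. A subshift is sofic if it is the image of an SFT under a continuous $G$-equivariant map. Medvedev degrees: for $P,Q\subset\{0,1\}^{\mathbb N}$ write $P\le Q$ if there is a partial computable function $\Psi$ on $\{0,1\}^{\mathbb N}$ (a Turing functional) defined on all of $Q$ with $\Psi(Q)\subset P$. The Medvedev degree $m(P)$ is the class of $P$ under the equivalence $P\le Q\le P$. For a group $G$ with finite generating set $S$, free group $F(S)$ and canonical epimorphism $\rho\colon F(S)\to G$, the pullback of a subshift $X\subset A^G$ is $\widehat X=\{x\circ\rho: x\in X\}\subset A^{F(S)}$. Via a computable bijection $\mathbb N\to F(S)$ and a fixed-length binary coding of $A$, $\widehat X$ is identified with a subset of $\{0,1\}^{\mathbb N}$, and $m(X):=m(\widehat X)$ (independent of choices).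 $\mathfrak{M}_{\mathtt{SFT}}(G)$ and $\mathfrak{M}_{\mathtt{SOF}}(G)$ are the sets of degrees $m(X)$ for $X$ a nonempty $G$-SFT, respectively a nonempty sofic $G$-subshift. *)

(* Defs.v *)
From HB Require Import structures.
From mathcomp Require Import all_boot finmap.
From mathcomp Require Import all_classical all_analysis.

Set Implicit Arguments.
Unset Strict Implicit.
Unset Printing Implicit Defensive.

Local Open Scope classical_set_scope.
Local Open Scope group_scope.

(** * Groups *)

Definition short_exact (N G H : groupType)
    (i : {multiplicative N -> G}) (p : {multiplicative G -> H}) : Prop :=
  [/\ injective i, range i = p @^-1` [set 1] & range p = setT].

(* F(S): reduced words over the letters s (coded (s, true)) and s^-1
   (coded (s, false)).  Only the underlying set of F(S) and the canonical
   epimorphism are needed, so the group law is not defined. *)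
Definition letter (G : groupType) (S : {fset G}) : finType := (S * bool)%type.

Definition reduced (G : groupType) (S : {fset G}) : pred (seq (letter S)) :=
  sorted (fun a b : letter S => ~~ ((a.1 == b.1) && (a.2 != b.2))).

Definition free_group (G : groupType) (S : {fset G}) : Type :=
  {w : seq (letter S) | reduced w}.

Definition rho (G : groupType) (S : {fset G}) (w : free_group S) : G :=
  \prod_(a <- val w) (if a.2 then val a.1 else (val a.1)^-1).

Definition generates (G : groupType) (S : {fset G}) : Prop :=
  range (@rho G S) = setT.

Definition finitely_generated (G : groupType) : Prop :=
  exists S : {fset G}, generates S.

(** * Subshifts *)

Definition config (G : groupType) (A : finType) : topologicalType :=
  prod_topology (fun _ : G => discrete_topology A).

Definition gshift (G : groupType) (A : finType) (g : G) (x : config G A)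
  : config G A := fun h => x (g^-1 * h).

Definition subshift (G : groupType) (A : finType) (X : set (config G A)) : Prop :=
  closed X /\ forall g x, X x -> X (gshift g x).

Definition cylinder (G : groupType) (A : finType) (p : {fmap G -> A})
  : set (config G A) :=
  [set x | forall h : domf p, x (val h) = p h].

Definition SFT (G : groupType) (A : finType) (X : set (config G A)) : Prop :=
  subshift X /\
  exists F : {fset {fmap G -> A}},
    X = [set x | forall g p, p \in F -> ~ cylinder p (gshift g x)].

(* A continuous equivariant map X -> Y is given by any function on the full
   shift that is continuous and equivariant on X. *)
Definition sofic (G : groupType) (B : finType) (Y : set (config G B)) : Prop :=
  subshift Y /\
  exists (A : finType) (X : set (config G A)) (phi : config G A -> config G B),
    [/\ SFT X, {within X, continuous phi},
        (forall g x, X x -> phi (gshift g x) = gshift g (phi x))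
      & phi @` X = Y].

(** * Computability relative to an oracle in {0,1}^nat *)

Definition cantor : Type := nat -> bool.

(* Kleene's partial recursive functions with an oracle. *)
Inductive prog : Type :=
  | Zero
  | Succ
  | Proj of nat
  | Oracle
  | Comp of prog & seq prog
  | PrimRec of prog & prog
  | Mu of prog.

(* [oeval x c v r]: with oracle x, the program c halts on the arguments v with
   value r.  Arguments missing from v count as 0. *)
Fixpoint oeval (x : cantor) (c : prog) (v : seq nat) (r : nat) {struct c} : Prop :=
  match c with
  | Zero => r = 0%N
  | Succ => r = (nth 0%N v 0).+1
  | Proj i => r = nth 0%N v i
  | Oracle => r = x (nth 0%N v 0) :> nat
  | Comp f gs => exists2 w : seq nat,
      (fix evals (gs : seq prog) (w : seq nat) {struct gs} : Prop :=
         match gs, w with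
         | [::], [::] => True
         | g :: gs', a :: w' => oeval x g v a /\ evals gs' w'
         | _, _ => False
         end) gs w
      & oeval x f w r
  | PrimRec f g => exists2 h : nat -> nat,
      oeval x f (behead v) (h 0%N) /\
      (forall k, (k < nth 0 v 0)%N -> oeval x g [:: k, h k & behead v] (h k.+1))
      & r = h (nth 0%N v 0)
  | Mu f => oeval x f (r :: v) 0%N /\
      forall k, (k < r)%N -> exists a, oeval x f (k :: v) a.+1
  end.

(* A program whose output does not depend on the oracle computes an ordinary
   recursive function. *)
Definition computable (f : nat -> nat) : Prop :=
  exists c : prog, forall x n, oeval x c [:: n] (f n).

(** * Medvedev degrees *)

Definition medvedev_le (P Q : set cantor) : Prop :=
  exists c : prog, forall q, Q q ->
    exists2 p, P p & forall n, oeval q c [:: n] (p n).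

Definition medvedev_degree (P : set cantor) : set (set cantor) :=
  [set Q | medvedev_le P Q /\ medvedev_le Q P].

Record binary_coding (A : finType) := BinaryCoding {
  code_len : nat;
  code_len_gt0 : (0 < code_len)%N;
  code_of : A -> code_len.-tuple bool;
  code_of_inj : injective code_of }.

Definition word_code (G : groupType) (S : {fset G}) (w : free_group S) : nat :=
  CodeSeq.code [seq nat_of_ord (enum_rank a) | a <- val w].

(* The choices entering the definition of m(X).  The degree does not depend on
   them.  Such a presentation exists for every finitely generated group;
   [enum_free_bij] forces [gens] to be nonempty, as F(S) must be infinite, so
   the trivial group is presented with S = {1}. *)
Record presentation (G : groupType) := Presentation {
  gens : {fset G};
  gens_generate : generates gens;
  enum_free : nat -> free_group gens;
  enum_free_bij : bijective enum_free;
  enum_free_computable : computable (fun n => word_code (enum_free n));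
  alphabet_coding : forall A : finType, binary_coding A }.

Definition pullback (G : groupType) (S : {fset G}) (A : finType)
    (X : set (config G A)) : set (free_group S -> A) :=
  [set y | exists2 x, X x & y = x \o @rho G S].

(* The code of the symbol at the n-th word occupies the n-th block of
   code_len bits. *)
Definition to_cantor (G : groupType) (c : presentation G) (A : finType)
    (y : free_group (gens c) -> A) : cantor :=
  let k := code_len (alphabet_coding c A) in
  fun m => nth false (code_of (alphabet_coding c A) (y (enum_free c (m %/ k)))) (m %% k).

Definition degree (G : groupType) (c : presentation G) (A : finType)
    (X : set (config G A)) : set (set cantor) :=
  medvedev_degree (@to_cantor G c A @` @pullback G (gens c) A X).

Definition M_SFT (G : groupType) (c : presentation G) : set (set (set cantor)) :=
  [set d | exists (A : finType) (X : set (config G A)),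
     [/\ SFT X, X !=set0 & d = degree c X]].

Definition M_SOF (G : groupType) (c : presentation G) : set (set (set cantor)) :=
  [set d | exists (A : finType) (X : set (config G A)),
     [/\ sofic X, X !=set0 & d = degree c X]].

(* Main.v *)
Require Import Defs.
From mathcomp Require Import all_boot finmap.
From mathcomp Require Import all_classical all_analysis.
From mathcomp Require Import zify.

Set Implicit Arguments.
Unset Strict Implicit.
Unset Printing Implicit Defensive.

Local Open Scope classical_set_scope.

(* The map [x |-> x \o p] embeds [A^H] into [A^G].  Its image consists of the
   configurations that are constant along the cosets of [i N], which is a
   condition of finite type because it suffices to test it on a finite
   generating set of [N]; the forbidden patterns of a subshift over [H] lift
   along a section of [p].  The Medvedev degree is unchanged: choosing for each
   generator of one group a word of the other with the same image in [H],
   substituting letter by letter and reducing freely gives a computable map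
   between the free groups through which the two pullbacks factor. *)

(** * Oracle computability *)

(** Programs are handled through the total functionals they compute, so that reductions can be
    assembled from closure properties. *)
Definition recursive (F : cantor -> seq nat -> nat) : Prop :=
  exists c, forall x v, oeval x c v (F x v).

(* Missing arguments count as 0, so a k-ary function is also applicable to
   longer argument lists. *)
Definition rec1 (f : nat -> nat) : Prop :=
  recursive (fun _ v => f (nth 0 v 0)).
Definition rec2 (f : nat -> nat -> nat) : Prop :=
  recursive (fun _ v => f (nth 0 v 0) (nth 0 v 1)).
Definition rec3 (f : nat -> nat -> nat -> nat) : Prop :=
  recursive (fun _ v => f (nth 0 v 0) (nth 0 v 1) (nth 0 v 2)).

Lemma rec_arg i : recursive (fun _ v => nth 0 v i).
Proof. by exists (Proj i). Qed.

(** Three slots serve all arities used below; for a function of fewer arguments one of the inner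
    functions is repeated. *)
Lemma rec_comp F G1 G2 G3 :
  recursive F -> recursive G1 -> recursive G2 -> recursive G3 ->
  recursive (fun x v => F x [:: G1 x v; G2 x v; G3 x v]).
Proof.
move=> [c cP] [c1 c1P] [c2 c2P] [c3 c3P].
by exists (Comp c [:: c1; c2; c3]) => x v; exists [:: G1 x v; G2 x v; G3 x v].
Qed.

Lemma rec1_app f G : rec1 f -> recursive G -> recursive (fun x v => f (G x v)).
Proof. by move=> hf hG; apply: (rec_comp hf hG hG hG). Qed.

Lemma rec2_app f G1 G2 : rec2 f -> recursive G1 -> recursive G2 ->
  recursive (fun x v => f (G1 x v) (G2 x v)).
Proof. by move=> hf h1 h2; apply: (rec_comp hf h1 h2 h2). Qed.

(** [computable] speaks of one-element argument lists only; composing with [Proj 0] cuts any list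
    down to its first argument. *)
Lemma rec_computable f : computable f -> rec1 f.
Proof.
case=> c cP; exists (Comp c [:: Proj 0]) => x v.
by exists [:: nth 0 v 0] => //; apply: cP.
Qed.

Lemma rec_oracle G : recursive G -> recursive (fun x v => x (G x v) : nat).
Proof.
by case=> c cP; exists (Comp Oracle [:: c]) => x v; exists [:: G x v].
Qed.

Lemma rec_S G : recursive G -> recursive (fun x v => (G x v).+1).
Proof.
by case=> c cP; exists (Comp Succ [:: c]) => x v; exists [:: G x v].
Qed.

Lemma rec_const n : recursive (fun _ _ => n).
Proof. by elim: n => [|n IHn]; [exists Zero | apply: rec_S]. Qed.

Lemma rec2_primrec b s (h : nat -> nat -> nat) : rec1 b -> rec3 s ->
  (forall p, h 0 p = b p) -> (forall k p, h k.+1 p = s k (h k p) p) ->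
  rec2 h.
Proof.
move=> [cb cbP] [cs csP] h0 hS; exists (PrimRec cb cs) => x v.
exists (h ^~ (nth 0 v 1)) => //; split=> [|k _].
  by rewrite h0 -nth_behead; apply: cbP.
by rewrite hS -[nth 0 v 1]nth_behead; apply: (csP x [:: k, _ & behead v]).
Qed.

Lemma rec1_mu g (f : nat -> nat) : rec2 g -> (forall p, g (f p) p = 0) ->
  (forall k p, k < f p -> g k p != 0) -> rec1 f.
Proof.
move=> [c cP] g0 gn0; exists (Mu c) => x v; split=> [|k ltkf].
  by have := cP x (f (nth 0 v 0) :: v); rewrite /= g0.
exists (g k (nth 0 v 0)).-1; rewrite prednK ?lt0n ?gn0 //.
Qed.

Lemma rec1_primrec b s (h : nat -> nat) : rec2 s ->
  h 0 = b -> (forall k, h k.+1 = s k (h k)) -> rec1 h.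
Proof.
move=> hs h0 hS.
have h2 : rec2 (fun n _ => h n).
  apply: (@rec2_primrec (fun=> b) (fun k r _ => s k r)) => //.
  exact: rec_const.
exact: (rec2_app h2 (rec_arg 0) (rec_const 0)).
Qed.

(** * Arithmetic and finite case distinctions *)

Lemma rec_add G1 G2 : recursive G1 -> recursive G2 ->
  recursive (fun x v => G1 x v + G2 x v).
Proof.
apply: (@rec2_app addn).
apply: (@rec2_primrec id (fun _ r _ => r.+1)) => //.
- exact: rec_arg.
- exact/rec_S/rec_arg.
Qed.

Lemma rec_mul G1 G2 : recursive G1 -> recursive G2 ->
  recursive (fun x v => G1 x v * G2 x v).
Proof.
apply: (@rec2_app muln).
apply: (@rec2_primrec (fun=> 0) (fun _ r p => p + r)) => //.
- exact: rec_const.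
- by apply: rec_add; apply: rec_arg.
Qed.

Lemma rec_pred G : recursive G -> recursive (fun x v => (G x v).-1).
Proof.
apply: rec1_app; apply: (@rec1_primrec 0 (fun k _ => k)) => //.
exact: rec_arg.
Qed.

Lemma rec_sub G1 G2 : recursive G1 -> recursive G2 ->
  recursive (fun x v => G1 x v - G2 x v).
Proof.
(* The recursion runs on the subtrahend, so the arguments are swapped. *)
move=> h1 h2; apply: (@rec2_app (fun n p => p - n) G2 G1) => //.
apply: (@rec2_primrec id (fun _ r _ => r.-1)) => [||p|k p].
- exact: rec_arg.
- exact/rec_pred/rec_arg.
- by rewrite subn0.
- by rewrite subnS.
Qed.

Lemma rec_if G (b : cantor -> seq nat -> bool) G1 G2 :
  recursive (fun x v => b x v : nat) -> recursive G1 -> recursive G2 ->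
  (forall x v, G x v = if b x v then G1 x v else G2 x v) -> recursive G.
Proof.
move=> hb h1 h2 GE.
(* Both branches are total, so the choice can be made arithmetically. *)
have -> : G = fun x v => b x v * G1 x v + (1 - b x v) * G2 x v.
  apply/funext => x; apply/funext => v; rewrite GE.
  by case: (b x v); rewrite ?mul1n ?mul0n ?addn0.
by do ![apply: rec_add | apply: rec_mul | apply: rec_sub | apply: rec_const].
Qed.

Lemma rec_eq0 G : recursive G -> recursive (fun x v => (G x v == 0) : nat).
Proof.
move=> hG; have -> : (fun x v => (G x v == 0) : nat) = fun x v => 1 - G x v.
  by apply/funext => x; apply/funext => v; case: (G x v).
exact: rec_sub (rec_const 1) hG.
Qed.

Lemma rec_eq G1 G2 : recursive G1 -> recursive G2 ->
  recursive (fun x v => (G1 x v == G2 x v) : nat).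
Proof.
move=> h1 h2; have -> : (fun x v => (G1 x v == G2 x v) : nat) =
    fun x v => ((G1 x v - G2 x v) + (G2 x v - G1 x v) == 0) : nat.
  by apply/funext => x; apply/funext => v; congr nat_of_bool; lia.
by apply: rec_eq0; apply: rec_add; apply: rec_sub.
Qed.

Lemma rec_ltn G1 G2 : recursive G1 -> recursive G2 ->
  recursive (fun x v => (G1 x v < G2 x v) : nat).
Proof.
by move=> h1 h2; apply: rec_eq0; apply: rec_sub => //; apply: rec_S.
Qed.

Lemma rec_nth (N F0 : cantor -> seq nat -> nat) Fs :
  recursive N -> recursive F0 -> (forall j, recursive (nth F0 Fs j)) ->
  recursive (fun x v => nth F0 Fs (N x v) x v).
Proof.
move=> hN h0; elim: Fs N hN => [|F Fs IHFs] N hN hFs.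
  by under eq_fun do under eq_fun do rewrite nth_nil.
apply: (@rec_if _ (fun x v => N x v == 0) F
  (fun x v => nth F0 Fs (N x v).-1 x v)).
- exact: rec_eq0.
- exact: (hFs 0).
- by apply: IHFs => [|j]; [apply: rec_pred | apply: (hFs j.+1)].
- by move=> x v; case: (N x v).
Qed.

Lemma rec_nth_const (s : seq nat) N : recursive N ->
  recursive (fun x v => nth 0 s (N x v)).
Proof.
move=> hN; have -> : (fun x v => nth 0 s (N x v)) =
    fun x v => nth (fun _ _ => 0) [seq (fun _ _ => a) | a <- s] (N x v) x v.
  apply/funext => x; apply/funext => v; elim: s (N x v) => [|a s IHs] [|n] //=.
apply: rec_nth => // [|j]; first exact: rec_const.
have [ltjs|lesj] := ltnP j (size s).
  by rewrite (nth_map 0) //; apply: rec_const.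
by rewrite nth_default ?size_map //; apply: rec_const.
Qed.

(** Branching on one bit after the other reaches each of the finitely many bit lists as a constant,
    so [F] has to be recursive only for each fixed list. *)
Lemma rec_bits (n : nat) (b : nat -> cantor -> seq nat -> bool)
    (F : seq bool -> cantor -> seq nat -> nat) :
  (forall j, recursive (fun x v => b j x v : nat)) ->
  (forall s, recursive (F s)) ->
  recursive (fun x v => F [seq b j x v | j <- iota 0 n] x v).
Proof.
move=> hb; elim: n 0 F => [|n IHn] m F hF; first exact: hF.
apply: (@rec_if _ (b m)
  (fun x v => F (true :: [seq b j x v | j <- iota m.+1 n]) x v)
  (fun x v => F (false :: [seq b j x v | j <- iota m.+1 n]) x v)) => //=.
- by apply: (IHn m.+1 (fun s => F (true :: s))) => s; apply: hF.
- by apply: (IHn m.+1 (fun s => F (false :: s))) => s; apply: hF.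
- by move=> x v; case: (b m x v).
Qed.

Lemma rec_divn k G : 0 < k -> recursive G -> recursive (fun x v => G x v %/ k).
Proof.
move=> k0; apply: (@rec1_app (fun m => m %/ k)).
(* The quotient is the least [q] with [m < (q + 1) * k]. *)
apply: (@rec1_mu (fun q m => m.+1 - q.+1 * k)) => [|m|q m].
- apply: rec_sub; first exact/rec_S/rec_arg.
  by apply: rec_mul; [apply/rec_S/rec_arg | apply: rec_const].
- by apply/eqP; rewrite subn_eq0 ltn_ceil.
- by rewrite subn_eq0 -ltnNge ltnS leq_divRL.
Qed.

Lemma rec_modn k G : 0 < k -> recursive G -> recursive (fun x v => G x v %% k).
Proof.
move=> k0 hG; have -> : (fun x v => G x v %% k) =
    fun x v => G x v - G x v %/ k * k.
  apply/funext => x; apply/funext => v.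
  by rewrite [X in X - _](divn_eq _ k) addKn.
apply: rec_sub => //; apply: rec_mul; last exact: rec_const.
exact: rec_divn.
Qed.

Lemma rec_odd G : recursive G -> recursive (fun x v => odd (G x v) : nat).
Proof.
apply: (@rec1_app (fun n => odd n : nat)).
apply: (@rec1_primrec 0 (fun _ r => 1 - r)) => // [|k].
- by apply: rec_sub; [apply: rec_const | apply: rec_arg].
- by rewrite /=; case: (odd k).
Qed.

Lemma rec_half G : recursive G -> recursive (fun x v => (G x v)./2).
Proof.
apply: (@rec1_app half).
apply: (@rec1_primrec 0 (fun k r => odd k + r)) => // [|k].
- by apply: rec_add; [apply/rec_odd/rec_arg | apply: rec_arg].
- by rewrite /= uphalf_half.
Qed.

Lemma rec_iter (f : nat -> nat) N G : rec1 f -> recursive N -> recursive G ->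
  recursive (fun x v => iter (N x v) f (G x v)).
Proof.
move=> hf; apply: (@rec2_app (fun n p => iter n f p)).
apply: (@rec2_primrec id (fun _ r _ => f r)) => //; first exact: rec_arg.
exact: (rec1_app hf (rec_arg 1)).
Qed.

(** * Codes of words *)

(** As [code (a :: s) = 2 ^ a * (2 * code s + 1)] and the empty list has code 0, the head is the
    2-adic valuation of a nonzero code. *)
Definition code_head (m : nat) : nat := head 0 (CodeSeq.decode m).
Definition code_tail (m : nat) : nat :=
  CodeSeq.code (behead (CodeSeq.decode m)).


Lemma code_headK s : code_head (CodeSeq.code s) = head 0 s.
Proof. by rewrite /code_head CodeSeq.codeK. Qed.

Lemma code_tailK s : code_tail (CodeSeq.code s) = CodeSeq.code (behead s).
Proof. by rewrite /code_tail CodeSeq.codeK. Qed.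

Lemma iter_code_tail k s :
  iter k code_tail (CodeSeq.code s) = CodeSeq.code (drop k s).
Proof.
elim: k => [|k IHk]; first by rewrite drop0.
by rewrite iterS IHk code_tailK -drop1 drop_drop.
Qed.

Lemma code_eq0 s : (CodeSeq.code s == 0) = nilp s.
Proof. by case: s => //= a s; rewrite muln_eq0 expn_eq0. Qed.

Lemma iter_half n m : iter n half (2 ^ n * m) = m.
Proof.
elim: n m => [|n IHn] m; first by rewrite mul1n.
by rewrite iterS expnSr -mulnA IHn mul2n doubleK.
Qed.

Lemma rec1_code_head : rec1 code_head.
Proof.
(* Halving is repeated until the value is odd; the factor [0 < m] ends the search at once for the
   empty list, whose default head is 0. *)
apply: (@rec1_mu (fun k m => (1 - odd (iter k half m)) * (0 < m))) => [|m|k m].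
- apply: rec_mul; last by apply: rec_ltn; [apply: rec_const | apply: rec_arg].
  apply: rec_sub; first exact: rec_const.
  by apply: rec_odd; apply: rec_iter; [apply: rec_half| |]; apply: rec_arg.
- rewrite -(CodeSeq.decodeK m) code_headK; case: (CodeSeq.decode m) => //= a s.
  by rewrite iter_half /= odd_double.
- rewrite -(CodeSeq.decodeK m) code_headK; case: (CodeSeq.decode m) => //= a s.
  (* After [k < a] halvings a factor 2 is left, so the value is still even. *)
  move=> ltka; rewrite muln_gt0 expn_gt0 /= muln1.
  rewrite -(subnKC ltka) addSnnS expnD -mulnA iter_half expnS -mulnA mul2n.
  by rewrite odd_double.
Qed.

Lemma rec1_code_tail : rec1 code_tail.
Proof.
(* Removing the power of 2 leaves [2 * code s + 1], and one more halving yields [code s]. *)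
have -> : code_tail = fun m => (iter (code_head m) half m)./2.
  apply/funext => m; rewrite -(CodeSeq.decodeK m) code_headK code_tailK.
  by case: (CodeSeq.decode m) => //= a s; rewrite iter_half /= uphalf_double.
apply: rec_half; apply: rec_iter; last exact: rec_arg.
  exact: rec_half (rec_arg 0).
exact: rec1_code_head.
Qed.

(** The size is the least number of tails that brings the code to 0. *)
Lemma rec1_code_size : rec1 (size \o CodeSeq.decode).
Proof.
apply: (@rec1_mu (fun k m => iter k code_tail m)) => [|m|k m] /=.
- by apply: rec_iter; [apply: rec1_code_tail| |]; apply: rec_arg.
- by rewrite -[X in iter _ _ X]CodeSeq.decodeK iter_code_tail drop_size.
- move=> ltk; rewrite -[X in iter _ _ X]CodeSeq.decodeK iter_code_tail code_eq0.
  by rewrite /nilp size_drop subn_eq0 -ltnNge.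
Qed.

Lemma rec_code_cons a G : recursive G ->
  recursive (fun x v => 2 ^ a * (G x v).*2.+1).
Proof.
move=> hG; apply: rec_mul; first exact: rec_const.
under eq_fun do under eq_fun do rewrite -addnn.
by apply: rec_S; apply: rec_add.
Qed.

(** A right fold consumes the list from its end, so it is a primitive recursion on the number of
    letters already consumed; each step reads its letter off the code and selects one of finitely
    many functions. *)
Lemma rec1_code_foldr (step : seq (nat -> nat)) :
  (forall j, rec1 (nth id step j)) ->
  rec1 (fun m => foldr (fun a => nth id step a) 0 (CodeSeq.decode m)).
Proof.
move=> hstep.
pose letter j m :=
  code_head (iter (size (CodeSeq.decode m) - j.+1) code_tail m).
pose h k m := iteri k (fun j => nth id step (letter j m)) 0.
have hletter G1 G2 : recursive G1 -> recursive G2 ->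
    recursive (fun x v => letter (G1 x v) (G2 x v)).
  move=> h1 h2; apply: (rec1_app rec1_code_head).
  apply: rec_iter => //; first exact: rec1_code_tail.
  by apply: rec_sub; [apply: (rec1_app rec1_code_size) | apply: rec_S].
have hh : rec2 h.
  apply: (@rec2_primrec (fun=> 0)
    (fun k r m => nth id step (letter k m) r)) => //.
    exact: rec_const.
  (* The default branch returns the accumulator, in agreement with the default [id] for letters
     outside the table. *)
  pose F0 (x : cantor) v := nth 0 v 1.
  have E : (fun (_ : cantor) v =>
      nth id step (letter (nth 0 v 0) (nth 0 v 2)) (nth 0 v 1)) =
    fun x v => nth F0 [seq (fun _ v => f (nth 0 v 1)) | f <- step]
      (letter (nth 0 v 0) (nth 0 v 2)) x v.
    apply/funext => x; apply/funext => v.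
    by elim: (step) (letter _ _) => [|f s IHs] [|n] //=.
  rewrite /rec3 [X in recursive X]E.
  apply: rec_nth => [||j]; first by apply: hletter; apply: rec_arg.
    exact: rec_arg.
  have [ltjs|lesj] := ltnP j (size step).
    by rewrite (nth_map id) //; apply: (rec1_app (hstep j) (rec_arg 1)).
  by rewrite nth_default ?size_map //; apply: rec_arg.
have -> : (fun m => foldr (fun a => nth id step a) 0 (CodeSeq.decode m)) =
    fun m => h (size (CodeSeq.decode m)) m.
  apply/funext => m; rewrite /h /letter.
  rewrite -[in RHS](CodeSeq.decodeK m) CodeSeq.codeK.
  set s := CodeSeq.decode m.
  (* Invariant: after [k] rounds the last [k] letters have been folded. *)
  suff hk k : k <= size s ->
      iteri k (fun j => nth id step (code_head (iter (size s - j.+1) code_tail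
        (CodeSeq.code s)))) 0 =
      foldr (fun a => nth id step a) 0 (drop (size s - k) s).
    by rewrite hk // subnn drop0.
  elim: k => [|k IHk] lek; first by rewrite subn0 drop_size.
  rewrite /= IHk 1?ltnW // iter_code_tail code_headK.
  have lts : size s - k.+1 < size s by rewrite ltn_subrL (leq_trans _ lek).
  by rewrite (drop_nth 0 lts) /= subnSK.
exact: (rec2_app hh rec1_code_size (rec_arg 0)).
Qed.

(** * Transitivity of Medvedev reducibility *)

Fixpoint oracle_subst (c d : prog) : prog :=
  match d with
  | Zero => Zero
  | Succ => Succ
  | Proj i => Proj i
  | Oracle => Comp c [:: Proj 0]
  | Comp f gs => Comp (oracle_subst c f) [seq oracle_subst c g | g <- gs]
  | PrimRec f g => PrimRec (oracle_subst c f) (oracle_subst c g)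
  | Mu f => Mu (oracle_subst c f)
  end.

Lemma oracle_substP (p q : cantor) c : (forall n, oeval q c [:: n] (p n)) ->
  forall d v r, oeval p d v r -> oeval q (oracle_subst c d) v r.
Proof.
(* [prog] is nested in [seq prog]; an explicit structural fixpoint gives the hypothesis for the
   arguments of [Comp] too. *)
move=> cP; fix IH 1; case=> [||i||f gs|f g|f] v r //=.
- by move=> ->; exists [:: nth 0 v 0].
- case=> w evals /IH fw; exists w => //.
  elim: gs w evals {fw} => [|g gs IHgs] [|a w] //= [/IH ga /IHgs gsw].
  by split.
- case=> h [/IH h0 hS] ->; exists h => //; split=> // k ltk.
  exact/IH/hS.
- by case=> /IH f0 fS; split=> // k /fS[a /IH fa]; exists a.
Qed.

Lemma medvedev_le_trans (P Q R : set cantor) :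
  medvedev_le P Q -> medvedev_le Q R -> medvedev_le P R.
Proof.
move=> [c cP] [d dP]; exists (oracle_subst d c) => r /dP[q Qq dq].
have [p Pp cp] := cP q Qq; exists p => // n.
exact: oracle_substP dq _ _ _ (cp n).
Qed.

Lemma eq_medvedev_degree (P Q : set cantor) :
  medvedev_le P Q -> medvedev_le Q P -> medvedev_degree P = medvedev_degree Q.
Proof.
move=> PQ QP; apply/seteqP; split=> R [PR RP]; split.
- exact: medvedev_le_trans QP PR.
- exact: medvedev_le_trans RP PQ.
- exact: medvedev_le_trans PQ PR.
- exact: medvedev_le_trans RP QP.
Qed.

(** * Substitution in reduced words *)

Lemma multiplicative1 (G K : groupType) (f : {multiplicative G -> K}) :
  f 1%g = 1%g.
Proof. by apply: (@mulgI K (f 1%g)); rewrite -gmulfM !mulg1. Qed.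

Lemma multiplicativeV (G K : groupType) (f : {multiplicative G -> K}) g :
  f (g^-1)%g = ((f g)^-1)%g.
Proof.
by apply: (@mulgI K (f g)); rewrite -gmulfM !mulgV multiplicative1.
Qed.

Definition letter_val (G : groupType) (S : {fset G}) (a : letter S) : G :=
  if a.2 then val a.1 else ((val a.1)^-1)%g.

(** This is [rho] extended to words that may be unreduced. *)
Definition word_val (G : groupType) (S : {fset G}) (w : seq (letter S)) : G :=
  (\prod_(a <- w) letter_val a)%g.

Definition letter_inv (G : groupType) (S : {fset G}) (a : letter S) :
    letter S :=
  (a.1, ~~ a.2).

(** Left multiplication by a letter in the free group: on a reduced word only the first letter can
    cancel. *)
Definition push (G : groupType) (S : {fset G}) (a : letter S)
    (w : seq (letter S)) : seq (letter S) :=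
  if w is b :: t then if b == letter_inv a then t else a :: w else [:: a].

Definition seq_code (G : groupType) (S : {fset G}) (w : seq (letter S)) : nat :=
  CodeSeq.code [seq nat_of_ord (enum_rank a) | a <- w].

(** The homomorphism of free groups determined by [u]; building the result by [push] from the empty
    word keeps it reduced. *)
Definition subst_word (G1 G2 : groupType) (S1 : {fset G1}) (S2 : {fset G2})
    (u : letter S1 -> seq (letter S2)) (w : seq (letter S1)) :
    seq (letter S2) :=
  foldr (fun a t => foldr (@push G2 S2) t (u a)) [::] w.

(** [push] read on codes, with [r] and [r'] the ranks of the letter and of its inverse. The test
    [0 < m] matters because the empty word has default head 0, which may equal [r']. *)
Definition push_code (r r' m : nat) : nat :=
  if (0 < m) && (code_head m == r') then code_tail m else 2 ^ r * m.*2.+1.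

Section Words.
Context (G : groupType) (S : {fset G}).
Implicit Types (a : letter S) (w : seq (letter S)).

Lemma seq_code_inj : injective (@seq_code G S).
Proof.
move=> w w' /(can_inj CodeSeq.codeK); apply: inj_map => a b.
by move/val_inj/enum_rank_inj.
Qed.

Lemma push_codeE a w :
  push_code (enum_rank a) (enum_rank (letter_inv a)) (seq_code w) =
  seq_code (push a w).
Proof.
rewrite /push_code lt0n code_eq0 code_headK code_tailK.
case: w => //= b w; have -> : (enum_rank b == enum_rank (letter_inv a) :> nat) =
   (b == letter_inv a) by rewrite (inj_eq val_inj) (inj_eq enum_rank_inj).
by case: ifP.
Qed.

Lemma rec1_push_code r r' : rec1 (push_code r r').
Proof.
apply: (@rec_if _
  (fun _ v => ~~ ((nth 0 v 0 == 0) || (code_head (nth 0 v 0) != r')))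
  (fun _ v => code_tail (nth 0 v 0)) (fun _ v => 2 ^ r * (nth 0 v 0).*2.+1)).
- apply: (@rec_if _ (fun _ v => nth 0 v 0 == 0) (fun _ _ => 0)
    (fun _ v => code_head (nth 0 v 0) == r')).
  + exact/rec_eq0/rec_arg.
  + exact: rec_const.
  + exact: rec_eq rec1_code_head (rec_const _).
  + by move=> _ v; case: eqP => //= _; rewrite negbK.
- exact: rec1_code_tail.
- exact: rec_code_cons (rec_arg 0).
- by move=> _ v; rewrite /push_code lt0n negb_or negbK.
Qed.

Lemma letter_valV a : letter_val (letter_inv a) = ((letter_val a)^-1)%g.
Proof. by case: a => g []; rewrite /letter_val //= invgK. Qed.

Lemma word_val_cons a w : word_val (a :: w) = (letter_val a * word_val w)%g.
Proof. exact: big_cons. Qed.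

Lemma word_val_push a w : word_val (push a w) = (letter_val a * word_val w)%g.
Proof.
case: w => [|b w] /=; first by rewrite word_val_cons.
case: eqP => [->|_]; last by rewrite word_val_cons.
by rewrite word_val_cons letter_valV mulVKg.
Qed.

Lemma word_val_foldr_push w w' :
  word_val (foldr (@push G S) w' w) = (word_val w * word_val w')%g.
Proof.
elim: w => [|a w IHw] /=; first by rewrite /word_val big_nil mul1g.
by rewrite word_val_push IHw word_val_cons mulgA.
Qed.

(** Without cancellation the only new adjacent pair is the one at the front, and it is not a pair of
    inverse letters. *)
Lemma reduced_push a w : reduced w -> reduced (push a w).
Proof.
case: w => [|b w] //= hw; case: ifP => [_|/negbT]; first exact: path_sorted hw.
rewrite /reduced /= => ba; apply/andP; split=> //; apply: contra ba.
by case: a b {hw} => [g s] [h t] /andP[/= /eqP<- ]; case: s t => [] [].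
Qed.

Lemma reduced_foldr_push w w' : reduced w' -> reduced (foldr (@push G S) w' w).
Proof. by move=> hw'; elim: w => //= a w; apply: reduced_push. Qed.

End Words.

Section Substitution.
Context (G1 G2 : groupType) (S1 : {fset G1}) (S2 : {fset G2}).
Context (u : letter S1 -> seq (letter S2)).

Lemma reduced_subst_word w : reduced (subst_word u w).
Proof. by elim: w => //= a w; apply: reduced_foldr_push. Qed.

(** The values are compared in [K], since [u] respects the letters only after mapping there. *)
Lemma word_val_subst (K : groupType) (f1 : {multiplicative G1 -> K})
    (f2 : {multiplicative G2 -> K}) w :
  (forall a, f2 (word_val (u a)) = f1 (letter_val a)) ->
  f2 (word_val (subst_word u w)) = f1 (word_val w).
Proof.
move=> hu; elim: w => [|a w IHw] /=.
  by rewrite /word_val !big_nil !multiplicative1.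
by rewrite word_val_foldr_push word_val_cons !gmulfM hu IHw.
Qed.

Lemma rec1_subst_word :
  exists2 T, rec1 T & forall w, T (seq_code w) = seq_code (subst_word u w).
Proof.
(* There are finitely many letters, so substitution uses a finite table, indexed by rank, of fixed
   compositions of [push_code]. *)
pose st (a : letter S1) m := foldr (fun b =>
  push_code (enum_rank b) (enum_rank (letter_inv b))) m (u a).
pose step := [seq st a | a <- enum (letter S1)].
exists (fun m => foldr (fun a => nth id step a) 0 (CodeSeq.decode m)).
  apply: rec1_code_foldr => j.
  have [ltj|lej] := ltnP j (size step); last first.
    by rewrite nth_default //; apply: rec_arg.
  rewrite size_map in ltj.
  (* An index inside the table provides a letter to serve as default for [nth_map]. *)
  have a : letter S1 by case: (enum (letter S1)) ltj => // a.
  rewrite (nth_map a) // /st; elim: (u _) => [|b w IHw] /=.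
    exact: rec_arg.
  exact: rec1_app (rec1_push_code _ _) IHw.
move=> w; rewrite /seq_code CodeSeq.codeK.
elim: w => [|a w IHw] //=; rewrite {}IHw -/(seq_code _).
rewrite (nth_map a) -?cardE // nth_enum_rank /st.
elim: (u a) => [|b w' IHw'] //=.
by rewrite IHw' push_codeE.
Qed.

End Substitution.

(** * Computable comparison of pullbacks to two free groups *)

Lemma rec1_enum_lookup (G1 G2 : groupType) (c1 : presentation G1)
    (c2 : presentation G2) (K : groupType) (f1 : {multiplicative G1 -> K})
    (f2 : {multiplicative G2 -> K}) : range f2 = setT ->
  exists2 f, rec1 f & forall n,
    f2 (rho (enum_free c2 (f n))) = f1 (rho (enum_free c1 n)).
Proof.
move=> f2T.
(* The choice of [u] is not effective, but it is finite data and can be built into a program. *)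
have /choice[u uP] (a : letter (gens c1)) : exists w : seq (letter (gens c2)),
    f2 (word_val w) = f1 (letter_val a).
  have [g _ <-] : range f2 (f1 (letter_val a)) by rewrite f2T.
  have [w _ <-] : range (@rho G2 (gens c2)) g by rewrite gens_generate.
  by exists (val w).
have [T hT TE] := rec1_subst_word u.
have [e2V e2K e2VK] := enum_free_bij c2.
pose f n := e2V (Sub (subst_word u (val (enum_free c1 n)))
  (reduced_subst_word u (val (enum_free c1 n)))).
have fE n : T (word_code (enum_free c1 n)) = word_code (enum_free c2 (f n)).
  by rewrite [LHS]TE /f e2VK.
exists f; last first.
  by move=> n; rewrite /f e2VK [LHS](word_val_subst _ uP).
have h1 := rec_computable (enum_free_computable c1).
have h2 := rec_computable (enum_free_computable c2).
(* [f] was defined by the inverse [e2V], for which no program is given; it is computed by searching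
   the second enumeration for the code of the substituted word. *)
apply: (@rec1_mu (fun k n =>
  1 - (word_code (enum_free c2 k) == T (word_code (enum_free c1 n))))).
- apply: rec_sub; first exact: rec_const.
  apply: rec_eq; first exact: h2.
  exact: rec1_app hT (rec1_app h1 (rec_arg 1)).
- by move=> n; rewrite fE eqxx.
- move=> k n ltk; rewrite fE; case: (word_code _ =P _) => //.
  move=> /seq_code_inj/val_inj.
  by move/(can_inj e2K) => kE; rewrite kE ltnn in ltk.
Qed.

(** Taking [f] to be [p] or the identity of [H] puts the pullbacks over [G] and over [H] into one
    form. *)
Definition factor_pullback (G K : groupType) (S : {fset G}) (f : G -> K)
    (A : finType) (X : set (config K A)) : set (free_group S -> A) :=
  [set y | exists2 x, X x & y = x \o f \o @rho G S].

(** For output bit [m], find the word of block [m %/ code_len b1], pass to a word of the other group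
    with the same image in [K], read and decode the symbol there, and encode it again in the first
    coding. *)
Lemma medvedev_le_factor_pullback (G1 G2 : groupType) (c1 : presentation G1)
    (c2 : presentation G2) (K : groupType) (f1 : {multiplicative G1 -> K})
    (f2 : {multiplicative G2 -> K}) (A : finType) (X : set (config K A)) :
  range f2 = setT ->
  medvedev_le (@to_cantor G1 c1 A @` factor_pullback f1 X)
              (@to_cantor G2 c2 A @` factor_pullback f2 X).
Proof.
move=> f2T; have [f hf fE] := rec1_enum_lookup c1 c2 f1 f2T.
set b1 := alphabet_coding c1 A; set b2 := alphabet_coding c2 A.
pose bit j (q : cantor) (v : seq nat) :=
  q (f (nth 0 v 0 %/ code_len b1) * code_len b2 + j).
(* Injectivity of the coding makes the decoded symbol unique; a block that codes no symbol gives
   [false]. *)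
pose out (s : seq bool) (_ : cantor) v : nat :=
  if [pick a | code_of b2 a == s :> seq bool] is Some a then
    nth false (code_of b1 a) (nth 0 v 0 %% code_len b1) else false.
have [c cP] : recursive (fun q v =>
    out [seq bit j q v | j <- iota 0 (code_len b2)] q v).
  apply: rec_bits => [j|s].
    apply: rec_oracle; apply: rec_add; last exact: rec_const.
    apply: rec_mul; last exact: rec_const.
    apply: (rec1_app hf); apply: rec_divn; first exact: code_len_gt0.
    exact: rec_arg.
  rewrite /out; case: pickP => [a _|_]; last exact: rec_const.
  have -> : (fun (_ : cantor) v =>
      nth false (code_of b1 a) (nth 0 v 0 %% code_len b1) : nat) =
    fun _ v => nth 0 (map nat_of_bool (code_of b1 a))
      (nth 0 v 0 %% code_len b1).
    apply/funext => x; apply/funext => v; rewrite (nth_map false) //.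
    by rewrite size_tuple ltn_mod code_len_gt0.
  by apply: rec_nth_const; apply: rec_modn (rec_arg 0); apply: code_len_gt0.
exists c => _ [_ [x Xx ->] <-].
exists (@to_cantor G1 c1 A (x \o f1 \o @rho G1 (gens c1))).
  by exists (x \o f1 \o @rho G1 (gens c1)) => //; exists x.
move=> m; set q := to_cantor _; set r := (X in oeval _ _ _ X).
suff -> : r = out [seq bit j q [:: m] | j <- iota 0 (code_len b2)] q [:: m].
  exact: cP.
pose n := m %/ code_len b1.
pose a := x (f1 (rho (enum_free c1 n))).
have bitE : [seq bit j q [:: m] | j <- iota 0 (code_len b2)] = code_of b2 a.
  rewrite -[RHS](@mkseq_nth _ false) size_tuple /mkseq.
  apply/eq_in_map => j; rewrite mem_iota add0n => /andP[_ ltj].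
  rewrite /bit /q /to_cantor -/b2 /= -/n divnMDl ?code_len_gt0 // divn_small //.
  by rewrite addn0 modnMDl modn_small // fE.
rewrite bitE /out; case: pickP => [a' /eqP/val_inj/code_of_inj->|/(_ a)].
  by [].
by rewrite eqxx.
Qed.

(** * Pulling back subshifts along an epimorphism *)

Lemma nbhs_config (G : groupType) (A : finType) (x : config G A) g :
  nbhs x [set y : config G A | y g = x g].
Proof.
apply: (@proj_continuous G (fun=> discrete_topology A) g x [set x g]).
exact: discrete_set1.
Qed.

Lemma cvg_config (G : groupType) (A : finType) (F : set_system (config G A))
    (x : config G A) : Filter F ->
  (forall g, F [set y : config G A | y g = x g]) -> F --> x.
Proof.
move=> FF hF; apply/cvg_sup => g U [_ [[B oB <-] Bx BU]].
by apply: filterS (hF g) => y yx; apply: BU; rewrite /= yx.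
Qed.

Definition precomp (G K : groupType) (A : finType) (f : G -> K)
    (x : config K A) : config G A := x \o f.

Lemma precomp_continuous (G K : groupType) (A : finType) (f : G -> K) :
  continuous (@precomp G K A f).
Proof.
move=> x; apply: (@cvg_config G A (precomp f @ nbhs x) (precomp f x)) => g.
exact: (nbhs_config x (f g)).
Qed.

(** A point of the closure agrees at both [g] and [h] with some element of the set. *)
Lemma closed_config_eq (G : groupType) (A : finType) (g h : G) :
  closed [set y : config G A | y g = y h].
Proof.
move=> x clx.
have [y [yE [yg yh]]] := clx _ (filterI (nbhs_config x g) (nbhs_config x h)).
by move: yg yh yE => /= <- <-.
Qed.

Section Pullback.
Context (N G H : groupType).
Context (i : {multiplicative N -> G}) (p : {multiplicative G -> H}).
Context (s : H -> G) (sK : cancel s p).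

Lemma precompK A (x : config H A) : precomp s (precomp p x) = x.
Proof. by apply/funext => h; rewrite /precomp /= sK. Qed.

Lemma gshift_precomp A g (x : config H A) :
  gshift g (precomp p x) = precomp p (gshift (p g) x).
Proof.
by apply/funext => h; rewrite /gshift /precomp /= gmulfM multiplicativeV.
Qed.

(** This displays the image as an intersection of closed conditions: constancy on the fibres of [p],
    and membership in [X] after restriction along the section. *)
Lemma precomp_imageE A (X : set (config H A)) :
  precomp p @` X = precomp s @^-1` X `&`
    \bigcap_g [set y : config G A | y g = y (s (p g))].
Proof.
apply/seteqP; split=> [_ [x Xx <-]|y [Xy yE]].
  split; first by rewrite /preimage /= precompK.
  by move=> g _; rewrite /precomp /= sK.
by exists (precomp s y) => //; apply/funext => g; rewrite [RHS](yE g).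
Qed.

Lemma subshift_precomp A (X : set (config H A)) :
  subshift X -> subshift (precomp p @` X).
Proof.
move=> [clX shX]; split.
  rewrite precomp_imageE; apply: closedI; last first.
    by apply: closed_bigI => g _; apply: closed_config_eq.
  apply: preimage_closed clX => x _; exact: precomp_continuous.
move=> g _ [x Xx <-]; rewrite gshift_precomp.
by exists (gshift (p g) x) => //; apply: shX.
Qed.

(** The support is moved along the section; there [p (s h) = h] lies in [domf q], so all values come
    from [q], and [a0] makes the lookup total. *)
Definition lift_pattern (A : finType) (a0 : A) (q : {fmap H -> A}) :
    {fmap G -> A} :=
  [fmap g : [fset s h | h in domf q]%fset => odflt a0 (q.[? p (val g)])%fmap].

Lemma cylinder_lift_pattern (A : finType) a0 q (x : config H A) :
  cylinder (@lift_pattern A a0 q) (precomp p x) <-> cylinder q x.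
Proof.
split=> hx h.
  have sh : s (val h) \in domf (lift_pattern a0 q).
    by apply: in_imfset; apply: valP.
  have := hx [`sh]%fset; rewrite /precomp /= sK => ->.
  rewrite /lift_pattern ffunE /= sK in_fnd ?valP //=.
  by congr (q _); apply: val_inj.
rewrite /lift_pattern ffunE /precomp /=.
have /imfsetP[k kq kE] := valP h.
rewrite kE /= sK in_fnd //=; exact: (hx [`kq]%fset).
Qed.

(** Forbidding these for all [a != b] in every translate forces [y g = y (g * t)] for all [g]. *)
Definition edge_pattern (A : finType) (t : G) (a b : A) : {fmap G -> A} :=
  [fmap g : [fset 1%g; t]%fset => if val g == 1%g then a else b].

Lemma cylinder_edge_pattern (A : finType) t (a b : A) (y : config G A) :
  t != 1%g -> cylinder (edge_pattern t a b) y <-> y 1%g = a /\ y t = b.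
Proof.
move=> t1; split=> [hy|[y1 yt] g].
  split.
    have h1 : (1%g : G) \in domf (edge_pattern t a b) by rewrite !inE eqxx.
    by have := hy [`h1]%fset; rewrite ffunE /= eqxx.
  have ht : t \in domf (edge_pattern t a b) by rewrite !inE eqxx orbT.
  by have := hy [`ht]%fset; rewrite ffunE /= (negbTE t1).
rewrite ffunE; have := valP g; rewrite !inE.
by case: eqP => [->|_ /eqP->].
Qed.

Context (T : {fset N}) (genT : generates T).
Context (kerE : range i = p @^-1` [set 1%g]).

(** Invariance under the generators passes to their inverses, then to words, hence to all of
    [range i], the kernel of [p]; and [g] differs from [s (p g)] by a kernel element. *)
Lemma factor_through_kernel (A : Type) (y : G -> A) :
  (forall g t, t \in T -> y (g * i t)%g = y g) ->
  forall g, y g = y (s (p g)).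
Proof.
move=> yT; have yL g (a : letter T) : y (g * i (letter_val a))%g = y g.
  case: a => t []; rewrite /letter_val /=; first exact: (yT _ _ (valP t)).
  (* Invariance under [t] is applied at the point [g * (i t)^-1]. *)
  by rewrite multiplicativeV -[in RHS](mulgVK (i (val t)) g) (yT _ _ (valP t)).
have yw g (w : seq (letter T)) : y (g * i (word_val w))%g = y g.
  elim: w g => [|a w IHw] g.
    by rewrite /word_val big_nil multiplicative1 mulg1.
  by rewrite word_val_cons gmulfM mulgA IHw yL.
move=> g; have [n _ nE] : range i (g^-1 * s (p g))%g.
  by rewrite kerE /= gmulfM multiplicativeV sK mulVg.
have [w _ wE] : range (@rho N T) n by rewrite genT.
by rewrite -[s (p g)](mulVKg g) -nE -wE [RHS]yw.
Qed.

Lemma SFT_precomp (A : finType) (X : set (config H A)) :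
  X !=set0 -> SFT X -> SFT (precomp p @` X).
Proof.
move=> [x0 _] [subX [F XE]]; split; first exact: subshift_precomp.
(* Nonemptiness of [X] supplies a symbol. *)
pose a0 : A := x0 1%g.
pose lifts := [seq lift_pattern a0 q | q <- F].
(* Generators with [i t = 1] are left out: their support would be a single point, and the pattern
   would forbid the symbol [a] itself. *)
pose edges := [seq edge_pattern (i t) ab.1 ab.2
  | t <- [seq t <- T | i t != 1%g],
    ab <- [seq ab <- enum {: A * A} | ab.1 != ab.2]].
exists [fset q in lifts ++ edges]%fset; apply/seteqP; split.
  move=> _ [x Xx <-] g q; rewrite !inE /= => /orP[/mapP[r rF ->]|].
    rewrite gshift_precomp => /cylinder_lift_pattern.
    by move: Xx; rewrite XE => /(_ (p g) r rF).
  case/allpairsP => -[t [a b]] [/=]; rewrite !mem_filter => /andP[t1 tT].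
  move=> /andP[/= /eqP ab _] -> /(cylinder_edge_pattern _ _ _ t1)[/= ga gb].
  apply: ab; rewrite -ga -gb gshift_precomp /precomp /=.
  have : range i (i t) by exists t.
  by rewrite kerE /= => ->; rewrite multiplicative1.
move=> y yF; have yE g : y g = y (s (p g)).
  apply: factor_through_kernel => {}g t tT.
  have [->|t1] := eqVneq (i t) 1%g; first by rewrite mulg1.
  apply/eqP/negPn/negP => yn.
  (* Shifting by [g^-1] brings the values at [g] and [g * i t] to [1] and [i t]. *)
  apply: (yF (g^-1)%g (edge_pattern (i t) (y g) (y (g * i t)%g))).
    rewrite !inE /=; apply/orP; right; apply/allpairsP.
    exists (t, (y g, y (g * i t)%g)).
    by split=> //=; rewrite mem_filter ?t1 //= eq_sym yn mem_enum.
  by apply/cylinder_edge_pattern => //; rewrite /gshift invgK mulg1.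
exists (precomp s y); last by apply/funext => g; rewrite [RHS]yE.
rewrite XE => h q qF hq.
(* A shift by [s h] upstairs acts as the shift by [h] below, since [p (s h) = h]. *)
apply: (yF (s h) (lift_pattern a0 q)).
  by rewrite !inE /= map_f.
have -> : y = precomp p (precomp s y) by apply/funext => g; rewrite [LHS]yE.
by rewrite gshift_precomp sK; apply/cylinder_lift_pattern.
Qed.

(** The SFT cover is pulled back along [p], and the factor map becomes restriction along [s], then
    [phi], then pullback along [p]. *)
Lemma sofic_precomp (B : finType) (Y : set (config H B)) :
  Y !=set0 -> sofic Y -> sofic (precomp p @` Y).
Proof.
move=> Y0 [subY [A [X [phi [sftX cphi ephi imX]]]]].
have [x0 Xx0] : X !=set0 by move: Y0; rewrite -imX => -[_ [x Xx _]]; exists x.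
rewrite -imX in subY *.
split; first exact: subshift_precomp.
exists A, (precomp p @` X), (precomp p \o phi \o precomp s); split.
- by apply: SFT_precomp => //; exists x0.
- apply/subspace_continuousP => _ [x Xx <-].
  apply: (@cvg_comp _ _ _ (phi \o precomp s) (precomp p) _
    (nbhs (phi (precomp s (precomp p x))))); last exact: precomp_continuous.
  (* [phi] is continuous only within [X], so the restriction along [s] must be seen to carry the
     pulled-back set into [X]. *)
  apply: (@cvg_comp _ _ _ (precomp s) phi _
    (within X (nbhs (precomp s (precomp p x))))).
    move=> U nU.
    have nV : nbhs (precomp p x) (precomp s @^-1` [set y | X y -> U y]).
      exact: (@precomp_continuous H G A s (precomp p x)) nU.
    apply: (filterS _ nV) => y XU [z Xz zy]; apply: XU.
    by rewrite -zy precompK.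
  by move/subspace_continuousP : cphi; apply; rewrite precompK.
- move=> g _ [x Xx <-].
  by rewrite gshift_precomp /= !precompK ephi // gshift_precomp.
- rewrite image_comp image_comp; apply: eq_imagel => x Xx /=.
  by rewrite precompK.
Qed.

End Pullback.

(** * Invariance of the degree and conclusion *)

Lemma degree_precomp (G H : groupType) (p : {multiplicative G -> H})
    (cG : presentation G) (cH : presentation H) (A : finType)
    (X : set (config H A)) :
  range p = setT -> degree cG (precomp p @` X) = degree cH X.
Proof.
move=> pT.
have GE : @pullback G (gens cG) A (precomp p @` X) =
    factor_pullback p X.
  apply/seteqP; split=> [_ [_ [x Xx <-] ->]|_ [x Xx ->]]; first by exists x.
  by exists (precomp p x) => //; exists x.
have HE : @pullback H (gens cH) A X = factor_pullback (@idfun H) X by [].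
(* Both [p] and the identity of [H] are onto, so the reduction applies in both directions. *)
rewrite /degree GE HE; apply: eq_medvedev_degree.
  apply: (medvedev_le_factor_pullback cG cH).
  by apply/seteqP; split=> // h _; exists h.
exact: (medvedev_le_factor_pullback cH cG).
Qed.

Theorem proposition4p8 (N G H : groupType)
  (i : {multiplicative N -> G}) (p : {multiplicative G -> H})
  (cG : presentation G) (cH : presentation H) :
  short_exact i p -> finitely_generated G -> finitely_generated N ->
  (M_SFT cH `<=` M_SFT cG) /\ (M_SOF cH `<=` M_SOF cG).
Proof.
move=> [_ kerE pT] _ [T genT].
(* A set-theoretic section of [p]; it need not be a homomorphism. *)
have /choice[s sK] h : exists g, p g = h.
  have [g _ gh] : range p h by rewrite pT.
  by exists g.
split=> d [A [X [hX [x Xx] ->]]]; exists A, (precomp p @` X).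
- split; last by rewrite (degree_precomp cG cH).
    by apply: (SFT_precomp sK genT kerE) => //; exists x.
  by exists (precomp p x), x.
- split; last by rewrite (degree_precomp cG cH).
    by apply: (sofic_precomp sK genT kerE) => //; exists x.
  by exists (precomp p x), x.
Qed.
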